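(* There is a product-preserving, faithful, essentially surjective functor from the category of right groups to the category of non-empty right heaps. It associates to every right group $(B,+)$ the right heap $(B,[-,-,-])$, where $[-,-,-]$ is the ternary operation on $B$ defined by $[a,b,c]=a+(b\backslash c)$ for all $a,b,c\in B$. The functor is the identity on morphisms.
   Context: A left quasigroup is a magma $(M,+)$ such that for all $a,b\in M$ there is a unique $x\in M$ with $a+x=b$; this $x$ is denoted $a\backslash b$. A right group is a non-empty left quasigroup whose operation is associative. The category of right groups is the full subcategory of the category of semigroups whose objects are the right groups (so morphisms are semigroup morphisms). A right heap is a pair $(H,[-,-,-])$, where $H$ is a set and $[-,-,-]\colon H\times H\times H\to H$ is a ternary operation which is associative ($[[x,y,z],w,u]=[x,y,[z,w,u]]$), left Mal'tsev ($[x,x,y]=y$) and right weakly Mal'tsev ($[x,y,[y,z,w]]=[x,z,w]$), for all $x,y,z,w,u\in H$. Morphisms of right heaps are the mappings $f$ with $f([x,y,z])=[f(x),f(y),f(z)]$ for all $x,y,z$. The category of non-empty right heaps is the full subcategory of right heaps with non-empty underlying set. *)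

(* Defs.v *)
From HB Require Import structures.
From mathcomp Require Import all_boot boolp.

Set Implicit Arguments.
Unset Strict Implicit.
Unset Printing Implicit Defensive.

Record category := Category {
  obj :> Type;
  hom : obj -> obj -> Type;
  idm : forall A, hom A A;
  cmp : forall A B C, hom B C -> hom A B -> hom A C;
  cmpA : forall A B C D (h : hom C D) (g : hom B C) (f : hom A B),
    cmp h (cmp g f) = cmp (cmp h g) f;
  idml : forall A B (f : hom A B), cmp (idm B) f = f;
  idmr : forall A B (f : hom A B), cmp f (idm A) = f }.

Arguments hom {c} A B.
Arguments idm {c} A.
Arguments cmp {c A B C} g f.

Definition full_subcategory (C : category) (P : C -> Prop) : category :=
  @Category {A : C | P A} (fun A B => hom (sval A) (sval B))
    (fun A => idm (sval A)) (fun A B D g f => cmp g f)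
    (fun A B D E h g f => cmpA h g f)
    (fun A B f => idml f) (fun A B f => idmr f).

Record prefunctor (C D : category) := Prefunctor {
  fobj :> C -> D;
  fmap : forall A B : C, hom A B -> hom (fobj A) (fobj B) }.

Arguments fmap {C D} p {A B} f.

Record functor (C D : category) := Functor {
  functor_pre :> prefunctor C D;
  fmap_id : forall A : C, fmap functor_pre (idm A) = idm (functor_pre A);
  fmap_cmp : forall (A B E : C) (g : hom B E) (f : hom A B),
    fmap functor_pre (cmp g f) = cmp (fmap functor_pre g) (fmap functor_pre f) }.

Definition faithful (C D : category) (F : functor C D) : Prop :=
  forall (A B : C) (f g : hom A B), fmap F f = fmap F g -> f = g.

Definition isomorphic (C : category) (A B : C) : Prop :=
  exists (f : hom A B) (g : hom B A), cmp g f = idm A /\ cmp f g = idm B.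

Definition essentially_surjective (C D : category) (F : functor C D) : Prop :=
  forall Y : D, exists X : C, isomorphic (F X) Y.

Definition is_product (C : category) (I : Type) (X : I -> C) (P : C)
    (p : forall i, hom P (X i)) : Prop :=
  forall (A : C) (f : forall i, hom A (X i)),
    exists! u : hom A P, forall i, cmp (p i) u = f i.

(* Arbitrary index types: this covers all small products, the empty one
   (terminal object) included. *)
Definition product_preserving (C D : category) (F : functor C D) : Prop :=
  forall (I : Type) (X : I -> C) (P : C) (p : forall i, hom P (X i)),
    is_product p -> is_product (X := fun i => F (X i)) (fun i => fmap F (p i)).

(* The operation [+] of a magma is written multiplicatively, as in MathComp.
   [semigroupType] is not used because it carries a choice structure. *)

Local Open Scope group_scope.

Lemma multiplicative_eq (M N : magmaType) (f g : {multiplicative M -> N}) :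
  f =1 g -> f = g.
Proof.
case: f g => f [[fM]] [g [[gM]]] /= /funext fg; rewrite fg in fM *.
by rewrite (Prop_irrelevance fM gM).
Qed.

Definition magma_id (M : magmaType) : {multiplicative M -> M} := idfun.

Definition magma_comp (M N P : magmaType) (g : {multiplicative N -> P})
  (f : {multiplicative M -> N}) : {multiplicative M -> P} := g \o f.

Program Definition MagmaCat : category :=
  @Category magmaType (fun M N => {multiplicative M -> N}) magma_id magma_comp
    _ _ _.
Next Obligation. by move=> *; apply: multiplicative_eq. Qed.
Next Obligation. by move=> *; apply: multiplicative_eq. Qed.
Next Obligation. by move=> *; apply: multiplicative_eq. Qed.

Definition SemigroupCat : category :=
  full_subcategory (C := MagmaCat) (fun M : magmaType => associative (@mul M)).

Definition left_quasigroup (M : magmaType) : Prop :=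
  forall a b : M, exists! x : M, a * x = b.

(* [ldiv qM a b] is the unique [x] such that [a * x = b]. *)
Definition ldiv (M : magmaType) (qM : left_quasigroup M) (a b : M) : M :=
  sval (cid (qM a b)).

Definition right_group (S : SemigroupCat) : Prop :=
  inhabited (sval S) /\ left_quasigroup (sval S).

Definition RightGroupCat : category := full_subcategory right_group.

Definition rg_magma (B : RightGroupCat) : magmaType := sval (sval B).

Definition rg_inhabited (B : RightGroupCat) : inhabited (rg_magma B) :=
  proj1 (svalP B).

Definition rg_left_quasigroup (B : RightGroupCat) :
  left_quasigroup (rg_magma B) := proj2 (svalP B).

Definition rg_fun (B C : RightGroupCat) (f : hom B C) :
  {multiplicative rg_magma B -> rg_magma C} := f.

Record is_right_heap (H : Type) (br : H -> H -> H -> H) : Prop := IsRightHeap {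
  bracketA : forall x y z w u, br (br x y z) w u = br x y (br z w u);
  bracket_left_maltsev : forall x y, br x x y = y;
  bracket_right_weakly_maltsev :
    forall x y z w, br x y (br y z w) = br x z w }.

Record right_heap := RightHeap {
  heap_sort :> Type;
  bracket : heap_sort -> heap_sort -> heap_sort -> heap_sort;
  bracketP : is_right_heap bracket }.

Definition heap_morphism (H K : right_heap) (f : H -> K) : Prop :=
  forall x y z : H, f (bracket x y z) = bracket (f x) (f y) (f z).

Record heap_hom (H K : right_heap) := HeapHom {
  heap_fun :> H -> K;
  heap_funP : heap_morphism heap_fun }.

Lemma heap_hom_eq (H K : right_heap) (f g : heap_hom H K) : f =1 g -> f = g.
Proof.
case: f g => f fP [g gP] /= /funext fg; rewrite fg in fP *.
by rewrite (Prop_irrelevance fP gP).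
Qed.

Definition heap_id (H : right_heap) : heap_hom H H :=
  @HeapHom H H id (fun _ _ _ => erefl).

Lemma heap_comp_subproof (H K L : right_heap) (g : heap_hom K L)
  (f : heap_hom H K) : heap_morphism (g \o f).
Proof. by move=> x y z /=; rewrite !heap_funP. Qed.

Definition heap_comp (H K L : right_heap) (g : heap_hom K L)
  (f : heap_hom H K) : heap_hom H L := HeapHom (heap_comp_subproof g f).

Program Definition RightHeapCat : category :=
  @Category right_heap heap_hom heap_id heap_comp _ _ _.
Next Obligation. by move=> *; apply: heap_hom_eq. Qed.
Next Obligation. by move=> *; apply: heap_hom_eq. Qed.
Next Obligation. by move=> *; apply: heap_hom_eq. Qed.

Definition NonemptyRightHeapCat : category :=
  full_subcategory (C := RightHeapCat) (fun H : right_heap => inhabited H).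

Definition rg_bracket (B : RightGroupCat) (a b c : rg_magma B) : rg_magma B :=
  a * ldiv (@rg_left_quasigroup B) b c.

Definition right_heap_of (B : RightGroupCat)
    (BP : is_right_heap (@rg_bracket B)) : NonemptyRightHeapCat :=
  exist (fun H : right_heap => inhabited H) (RightHeap BP) (rg_inhabited B).

(* Main.v *)
From HB Require Import structures.
Require Import Defs.
From mathcomp Require Import all_boot boolp.

(** Write [a \ b] for [ldiv a b]. By definition [a * (a \ b) = b], and since left
    translations are injective, [a \ (a * b) = b] and
    [a \ (b * c) = (a \ b) * c] in every right group. These identities give the
    three axioms of a right heap for [a * (b \ c)]. Semigroup morphisms preserve
    [\], hence the bracket, so the construction is a functor that acts as the
    identity on maps, and is therefore faithful.

    Essential surjectivity ([essentially_surjective_rg_functor]). Pick a point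
    [e] of a non-empty right heap. Then [a * b := [a, e, b]] is a right group
    with [a \ b = [e, a, b]], and its bracket [[a, e, [e, b, c]]] is [[a, b, c]]
    by the right weak Mal'tsev law. The heap obtained is thus the original one,
    not merely isomorphic to it through a nontrivial map.

    Preservation of products ([product_preserving_rg_functor]). The functor is
    not full, so the universal property of a product [P] of right groups [X_i]
    does not apply to heap morphisms into [P]. However, the cartesian product of
    the [X_i] with pointwise operation is a right group, so [P] is isomorphic to
    it, say through [u]. Brackets in the cartesian product are computed
    pointwise, so heap morphisms [f_i] tuple to a heap morphism into it, and
    composing with the heap morphism [u] gives the mediating morphism into [P]. *)

Set Implicit Arguments.
Unset Strict Implicit.
Unset Printing Implicit Defensive.

Local Open Scope group_scope.

(** * Left division in a right group *)

Section LeftDivision.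

Variables (M : magmaType) (qM : left_quasigroup M).

Lemma mul_ldiv (a b : M) : a * ldiv qM a b = b.
Proof. by rewrite /ldiv; case: cid => x []. Qed.

Lemma left_quasigroup_mulI (a x y : M) : a * x = a * y -> x = y.
Proof. by case: (qM a (a * y)) => z [_ zP] /zP <-; apply: zP. Qed.

Lemma ldiv_mul (a b : M) : ldiv qM a (a * b) = b.
Proof. by apply: (@left_quasigroup_mulI a); rewrite mul_ldiv. Qed.

Hypothesis mulMA : associative (@mul M).

Lemma ldiv_mulA (a b c : M) : ldiv qM a (b * c) = ldiv qM a b * c.
Proof. by apply: (@left_quasigroup_mulI a); rewrite mulMA !mul_ldiv. Qed.

End LeftDivision.

Lemma multiplicative_ldiv (M N : magmaType) (qM : left_quasigroup M)
    (qN : left_quasigroup N) (f : {multiplicative M -> N}) (a b : M) :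
  f (ldiv qM a b) = ldiv qN (f a) (f b).
Proof.
by apply: (left_quasigroup_mulI qN (a := f a)); rewrite -gmulfM !mul_ldiv.
Qed.

(** * The functor *)

Lemma rg_mulA (B : RightGroupCat) : associative (@mul (rg_magma B)).
Proof. exact: svalP (sval B). Qed.

Lemma rg_bracketP (B : RightGroupCat) : is_right_heap (@rg_bracket B).
Proof.
have mA := @rg_mulA B; split=> [x y z w u|x y|x y z w]; rewrite /rg_bracket.
- by rewrite -mA ldiv_mulA.
- exact: mul_ldiv.
- by rewrite ldiv_mul.
Qed.

Lemma rg_fun_heap_morphism (B C : RightGroupCat) (f : hom B C) :
  @heap_morphism (RightHeap (rg_bracketP B)) (RightHeap (rg_bracketP C))
    (rg_fun f).
Proof.
move=> x y z; rewrite /bracket /rg_bracket gmulfM.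
by rewrite (multiplicative_ldiv _ (@rg_left_quasigroup C)).
Qed.

Definition rg_prefunctor : prefunctor RightGroupCat NonemptyRightHeapCat :=
  @Prefunctor RightGroupCat NonemptyRightHeapCat
    (fun B => right_heap_of (rg_bracketP B))
    (fun B C f => HeapHom (@rg_fun_heap_morphism B C f)).

Lemma rg_prefunctor_id (B : RightGroupCat) :
  fmap rg_prefunctor (idm B) = idm (rg_prefunctor B).
Proof. exact: heap_hom_eq. Qed.

Lemma rg_prefunctor_cmp (B C D : RightGroupCat) (g : hom C D) (f : hom B C) :
  fmap rg_prefunctor (cmp g f) =
    cmp (fmap rg_prefunctor g) (fmap rg_prefunctor f).
Proof. exact: heap_hom_eq. Qed.

Definition rg_functor : functor RightGroupCat NonemptyRightHeapCat :=
  Functor rg_prefunctor_id rg_prefunctor_cmp.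

Lemma heap_hom_eqfun (H K : right_heap) (f g : heap_hom H K) : f = g -> f =1 g.
Proof. by move=> ->. Qed.

Lemma faithful_rg_functor : faithful rg_functor.
Proof.
move=> B C f g fg; apply: multiplicative_eq => x.
exact: (heap_hom_eqfun fg x).
Qed.

(** * Building right groups and their morphisms *)

Lemma multiplicative_eqfun (M N : magmaType) (f g : {multiplicative M -> N}) :
  f = g -> f =1 g.
Proof. by move=> ->. Qed.

Definition magma_of (T : Type) (m : T -> T -> T) : magmaType :=
  HB.pack T (hasMul.Build T m).

Definition right_group_of (T : Type) (m : T -> T -> T) (mA : associative m)
    (T_inh : inhabited T) (mq : left_quasigroup (magma_of m)) : RightGroupCat :=
  exist right_group (exist (fun M : magmaType => associative (@mul M))
    (magma_of m) mA) (conj T_inh mq).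

Definition multiplicative_of (M N : magmaType) (f : M -> N)
    (fM : {morph f : x y / x * y}) : {multiplicative M -> N} :=
  HB.pack f (isMultiplicative.Build M N f fM).

(** * Essential surjectivity *)

Section PointedHeap.

Variables (H : right_heap) (e : H).

Definition pointed_mul (a b : H) : H := bracket a e b.

Lemma pointed_mulA : associative pointed_mul.
Proof. by move=> a b c; rewrite /pointed_mul (bracketA (bracketP H)). Qed.

Lemma pointed_mulKV (a b : H) : pointed_mul a (bracket e a b) = b.
Proof.
rewrite /pointed_mul (bracket_right_weakly_maltsev (bracketP H)).
exact: (bracket_left_maltsev (bracketP H)).
Qed.

Lemma pointed_mulK (a b : H) : bracket e a (pointed_mul a b) = b.
Proof.
rewrite /pointed_mul (bracket_right_weakly_maltsev (bracketP H)).
exact: (bracket_left_maltsev (bracketP H)).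
Qed.

Lemma pointed_left_quasigroup : left_quasigroup (magma_of pointed_mul).
Proof.
move=> a b; exists (bracket e a b); split; first exact: pointed_mulKV.
by move=> x <-; apply: pointed_mulK.
Qed.

Definition pointed_right_group : RightGroupCat :=
  right_group_of pointed_mulA (inhabits e) pointed_left_quasigroup.

Lemma pointed_rg_bracket (a b c : H) :
  @rg_bracket pointed_right_group a b c = bracket a b c.
Proof.
rewrite /rg_bracket; set d := ldiv (@rg_left_quasigroup pointed_right_group)
  (b : magma_of pointed_mul) c.
have -> : d = bracket e b c :> H.
  apply: (left_quasigroup_mulI pointed_left_quasigroup (a := b)).
  by rewrite /d mul_ldiv; symmetry; apply: pointed_mulKV.
exact: (bracket_right_weakly_maltsev (bracketP H)).
Qed.

End PointedHeap.

Lemma essentially_surjective_rg_functor : essentially_surjective rg_functor.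
Proof.
case=> H [e]; exists (pointed_right_group e).
have idP : @heap_morphism (RightHeap (rg_bracketP (pointed_right_group e))) H id.
  by move=> a b c; apply: pointed_rg_bracket.
have idVP : @heap_morphism H (RightHeap (rg_bracketP (pointed_right_group e))) id.
  by move=> a b c; rewrite -[LHS]pointed_rg_bracket.
by exists (HeapHom idP), (HeapHom idVP); split; apply: heap_hom_eq.
Qed.

(** * Preservation of products *)

Section CartesianProduct.

Variables (I : Type) (X : I -> RightGroupCat).

Definition prod_mul (x y : forall i, rg_magma (X i)) (i : I) :
  rg_magma (X i) := x i * y i.

Lemma prod_mulA : associative prod_mul.
Proof.
by move=> x y z; apply: functional_extensionality_dep => i; apply: rg_mulA.
Qed.

(** [I] is arbitrary: this is the axiom of choice. *)
Lemma prod_inhabited : inhabited (forall i, rg_magma (X i)).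
Proof.
suff x i : {x : rg_magma (X i) | True} by constructor=> i; exact: sval (x i).
by apply: cid; case: (rg_inhabited (X i)) => x; exists x.
Qed.

Lemma prod_left_quasigroup : left_quasigroup (magma_of prod_mul).
Proof.
move=> a b; exists (fun i => ldiv (@rg_left_quasigroup (X i)) (a i) (b i)).
split=> [|x <-]; apply: functional_extensionality_dep => i.
  exact: mul_ldiv.
exact: ldiv_mul.
Qed.

Definition prod_right_group : RightGroupCat :=
  right_group_of prod_mulA prod_inhabited prod_left_quasigroup.

Definition prod_proj (i : I) : hom prod_right_group (X i) :=
  @multiplicative_of (magma_of prod_mul) (rg_magma (X i)) (fun x => x i)
    (fun _ _ => erefl).

Lemma prod_tuple_morph (P : RightGroupCat) (p : forall i, hom P (X i)) :
  {morph (fun (x : rg_magma P) i => rg_fun (p i) x) : x y /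
    x * y >-> (x : magma_of prod_mul) * y}.
Proof.
by move=> x y; apply: functional_extensionality_dep => i; apply: gmulfM.
Qed.

Definition prod_tuple (P : RightGroupCat) (p : forall i, hom P (X i)) :
    hom P prod_right_group :=
  @multiplicative_of (rg_magma P) (magma_of prod_mul) _ (prod_tuple_morph p).

(** The projections are morphisms of right groups, so they preserve brackets. *)
Lemma prod_rg_bracket (x y z : rg_magma prod_right_group) (i : I) :
  rg_bracket x y z i = @rg_bracket (X i) (x i) (y i) (z i).
Proof. exact: (rg_fun_heap_morphism (prod_proj i) x y z). Qed.

End CartesianProduct.

Lemma product_preserving_rg_functor : product_preserving rg_functor.
Proof.
move=> I X P p prodP A f.
have [u [pu _]] := prodP (prod_right_group X) (@prod_proj I X).
(* By the uniqueness half of the universal property, [u] is a left inverse of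
   the tuple of the [p i]; hence the [p i] are jointly injective, which makes
   the mediating heap morphism unique. *)
have uK x : rg_fun u (rg_fun (prod_tuple p) x) = x.
  have [w [_ w_uniq]] := prodP P p.
  have wid : w = idm P by apply: w_uniq => i; apply: idmr.
  have wu : w = cmp u (prod_tuple p).
    by apply: w_uniq => i; rewrite cmpA pu; apply: multiplicative_eq.
  exact: (multiplicative_eqfun (etrans (esym wu) wid) x).
have pE i x : rg_fun (p i) (rg_fun u x) = x i.
  exact: (multiplicative_eqfun (pu i) x).
pose fE i : heap_hom (sval A) (RightHeap (rg_bracketP (X i))) := f i.
have tupleP : @heap_morphism (sval A)
    (RightHeap (rg_bracketP (prod_right_group X))) (fun a i => fE i a).
  move=> x y z; apply: functional_extensionality_dep => i.
  by rewrite [RHS]prod_rg_bracket heap_funP.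
exists (heap_comp (HeapHom (rg_fun_heap_morphism u)) (HeapHom tupleP)); split.
  by move=> i; apply: heap_hom_eq => a; apply: pE.
move=> w wP; apply: heap_hom_eq => a /=; rewrite -[RHS]uK.
congr (rg_fun u _); apply: functional_extensionality_dep => i.
exact: esym (heap_hom_eqfun (wP i) a).
Qed.

Theorem theorem2p8 :
  exists (F : functor RightGroupCat NonemptyRightHeapCat)
    (heapP : forall B : RightGroupCat, is_right_heap (@rg_bracket B))
    (homP : forall (B C : RightGroupCat) (f : hom B C),
      @heap_morphism (RightHeap (heapP B)) (RightHeap (heapP C)) (rg_fun f)),
  [/\ functor_pre F =
        @Prefunctor RightGroupCat NonemptyRightHeapCat
          (fun B => right_heap_of (heapP B))
          (fun B C f => HeapHom (homP B C f)),
      product_preserving F,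
      faithful F
    & essentially_surjective F].
Proof.
exists rg_functor, rg_bracketP, rg_fun_heap_morphism; split=> //.
- exact: product_preserving_rg_functor.
- exact: faithful_rg_functor.
- exact: essentially_surjective_rg_functor.
Qed.
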